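(* Let $S,\bar S\subset\mathbb{R}^3$ be smooth surfaces, let $F:S\to\bar S$ be an isometry, and let $\gamma$ be a (unit speed) rectifying curve on $S$, contained in the image of a surface patch $\phi:U\to S$, with $\gamma(s)=\phi(u(s),v(s))$ and $$\gamma(s)=\lambda(s)\,\vec t(s)+\mu(s)\,\vec b(s),$$ where $\vec t,\vec b$ are the unit tangent and binormal of $\gamma$ and $k(s)>0$ is its curvature. Put $\bar\gamma=F\circ\gamma$, and assume that $\bar\gamma''(s)\neq 0$ for all $s$. Let $F_*=F_*(u,v)$ be the $3\times 3$ matrix-valued function on $U$ described in the context. If for all $s$ $$\begin{aligned}\bar\gamma(s)-F_*(\gamma(s))=\frac{\mu(s)}{k(s)}\Big[&u'^3\Big(F_*\phi_u\times\frac{\partial F_*}{\partial u}\phi_u\Big)+2u'^2v'\Big(F_*\phi_u\times\frac{\partial F_*}{\partial u}\phi_v\Big)+u'v'^2\Big(F_*\phi_u\times\frac{\partial F_*}{\partial v}\phi_v\Big)\\&+u'^2v'\Big(F_*\phi_v\times\frac{\partial F_*}{\partial u}\phi_u\Big)+2u'v'^2\Big(F_*\phi_v\times\frac{\partial F_*}{\partial u}\phi_v\Big)+v'^3\Big(F_*\phi_v\times\frac{\partial F_*}{\partial v}\phi_v\Big)\Big],\end{aligned}$$ where $u',v'$ are evaluated at $s$ and $F_*$, its partial derivatives, $\phi_u$ and $\phi_v$ are evaluated at $(u(s),v(s))$, then $\bar\gamma$ is a rectifying curve on $\bar S$.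
   Context: Curves: all curves are unit speed curves $\gamma:(\alpha,\beta)\to\mathbb{R}^3$ having at least fourth order continuous derivatives and with $\gamma''(s)\neq0$ for all $s$; $'$ denotes differentiation with respect to arc length $s$. The tangent is $\vec t=\gamma'$, the curvature $k>0$ and unit normal $\vec n$ are defined by $\vec t'=k\vec n$, and the binormal is $\vec b=\vec t\times\vec n$. Rectifying curve: such a curve $\gamma$ is called rectifying if its position vector always lies in the plane spanned by $\vec t$ and $\vec b$, i.e. $\gamma(s)=\lambda(s)\vec t(s)+\mu(s)\vec b(s)$ for some functions $\lambda,\mu$. A rectifying curve on a surface $S\subset\mathbb{R}^3$ is a rectifying curve whose image lies in $S$. Isometry: a diffeomorphism $F:S\to\bar S$ between smooth surfaces in $\mathbb{R}^3$ which takes every curve on $S$ to a curve of the same length on $\bar S$. Patches and $F_*$: $\phi:U\to S$ ($U\subset\mathbb{R}^2$ open) is a smooth regular surface patch (coordinate chart) with partial derivatives $\phi_u,\phi_v$, and $\bar\phi=F\circ\phi$ is the corresponding patch of $\bar S$. The normals are $\vec N=\phi_u\times\phi_v$ and $\vec{\bar N}=\bar\phi_u\times\bar\phi_v$. The differential of $F$ is regarded as an orthogonal $3\times3$ matrix $F_*=F_*(u,v)$ depending on the point $\phi(u,v)$: it is the orthogonal matrix with $F_*\phi_u=\bar\phi_u$, $F_*\phi_v=\bar\phi_v$ and $F_*\vec N=\vec{\bar N}$. The matrices $\partial F_*/\partial u$ and $\partial F_*/\partial v$ are its entrywise partial derivatives. $F_*(\gamma(s))$ denotes the product of the $3\times3$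 matrix $F_*(u(s),v(s))$ with the column vector $\gamma(s)\in\mathbb{R}^3$. *)

(* Defs.v *)
From HB Require Import structures.
From mathcomp Require Import all_boot all_order all_algebra.
From mathcomp Require Import all_classical all_reals all_analysis.

Set Implicit Arguments.
Unset Strict Implicit.
Unset Printing Implicit Defensive.

Import Order.TTheory GRing.Theory Num.Theory.
Import numFieldNormedType.Exports.

Local Open Scope ring_scope.
Local Open Scope classical_set_scope.

(* [Ck n U f], for an open set [U]: [f] is n times continuously differentiable
   on [U].  In finite dimension, continuity of all the directional derivatives
   ['D_v f] is continuity of the differential. *)
Fixpoint Ck (R : realType) (V W : normedModType R) (n : nat) (U : set V)
    (f : V -> W) : Prop :=
  match n with
  | 0%N => forall x, U x -> {for x, continuous f}
  | m.+1 => (forall x, U x -> differentiable f x) /\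
            (forall v : V, Ck m U ('D_v f))
  end.

Definition smooth_on (R : realType) (V W : normedModType R) (U : set V)
    (f : V -> W) : Prop :=
  forall n : nat, Ck n U f.

Definition homeomorphism_on (X Y : topologicalType) (A : set X) (B : set Y)
    (f : X -> Y) : Prop :=
  [/\ set_bij A B f, {within A, continuous f} &
      exists g : Y -> X, {in A, cancel f g} /\ {within B, continuous g}].

(* The library norm on ['cV[R]_3] is the sup norm, hence a separate [enorm]. *)
Definition enorm (R : realType) (a : 'cV[R]_3) : R :=
  Num.sqrt (\sum_i a i 0 ^+ 2).

(* The additions in ['I_3] are modulo 3. *)
Definition crossmul (R : realType) (a b : 'cV[R]_3) : 'cV[R]_3 :=
  \col_(i < 3) (a (i + 1) 0 * b (i + 2%:R) 0 - a (i + 2%:R) 0 * b (i + 1) 0).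

Notation "a \cross b" := (crossmul a b)
  (at level 40, left associativity) : ring_scope.

Definition pdu (R : realType) (W : normedModType R) (f : R * R -> W) :
  R * R -> W := 'D_((1, 0) : R * R) f.
Definition pdv (R : realType) (W : normedModType R) (f : R * R -> W) :
  R * R -> W := 'D_((0, 1) : R * R) f.

Definition patch_normal (R : realType) (phi : R * R -> 'cV[R]_3)
    (p : R * R) : 'cV[R]_3 :=
  pdu phi p \cross pdv phi p.

Definition regular_patch (R : realType) (S : set 'cV[R]_3) (U : set (R * R))
    (phi : R * R -> 'cV[R]_3) : Prop :=
  [/\ open U,
      smooth_on U phi,
      (forall p, U p -> patch_normal phi p != 0) &
      exists W : set 'cV[R]_3, open W /\ homeomorphism_on U (S `&` W) phi].

Definition smooth_surface (R : realType) (S : set 'cV[R]_3) : Prop :=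
  forall x, S x -> exists (U : set (R * R)) (phi : R * R -> 'cV[R]_3),
    regular_patch S U phi /\ (phi @` U) x.

(* Maps between surfaces are represented by functions on the whole space, of
   which only the values on the source surface matter; [g] is the inverse of
   the patch [psi]. *)
Definition smooth_map (R : realType) (S T : set 'cV[R]_3)
    (F : 'cV[R]_3 -> 'cV[R]_3) : Prop :=
  [/\ set_fun S T F,
      {within S, continuous F} &
      forall (U V : set (R * R)) (phi psi : R * R -> 'cV[R]_3)
        (g : 'cV[R]_3 -> R * R),
        regular_patch S U phi -> regular_patch T V psi ->
        {in V, cancel psi g} ->
        smooth_on (U `&` (F \o phi) @^-1` (psi @` V)) (g \o F \o phi)].

Definition diffeomorphism (R : realType) (S T : set 'cV[R]_3)
    (F : 'cV[R]_3 -> 'cV[R]_3) : Prop :=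
  exists G : 'cV[R]_3 -> 'cV[R]_3,
    [/\ smooth_map S T F, smooth_map T S G,
        {in S, cancel F G} & {in T, cancel G F}].

Definition oitv (R : realType) (a b : \bar R) : set R :=
  [set s : R | (a < s%:E)%E /\ (s%:E < b)%E].

Definition curve_length (R : realType) (I : set R) (c : R -> 'cV[R]_3) :
    \bar R :=
  (\int[@lebesgue_measure R]_(s in I) (enorm (derive1 c s))%:E)%E.

Definition surface_isometry (R : realType) (S T : set 'cV[R]_3)
    (F : 'cV[R]_3 -> 'cV[R]_3) : Prop :=
  diffeomorphism S T F /\
  forall (a b : \bar R) (c : R -> 'cV[R]_3),
    Ck 1 (oitv a b) c -> (forall s, oitv a b s -> S (c s)) ->
    curve_length (oitv a b) (F \o c) = curve_length (oitv a b) c.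

Section Frenet.
Context (R : realType) (gamma : R -> 'cV[R]_3).

Definition tangent : R -> 'cV[R]_3 := derive1 gamma.
Definition curvature (s : R) : R := enorm (derive1 tangent s).
Definition unit_normal (s : R) : 'cV[R]_3 :=
  (curvature s)^-1 *: derive1 tangent s.
Definition binormal (s : R) : 'cV[R]_3 := tangent s \cross unit_normal s.

End Frenet.

Definition unit_speed_curve (R : realType) (a b : \bar R)
    (gamma : R -> 'cV[R]_3) : Prop :=
  Ck 4 (oitv a b) gamma /\
  forall s, oitv a b s -> enorm (derive1 gamma s) = 1 /\ derive1 (derive1 gamma) s != 0.

Definition rectifying_curve (R : realType) (a b : \bar R)
    (gamma : R -> 'cV[R]_3) : Prop :=
  unit_speed_curve a b gamma /\
  exists lambda mu : R -> R, forall s, oitv a b s ->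
    gamma s = lambda s *: tangent gamma s + mu s *: binormal gamma s.

Definition rectifying_curve_on (R : realType) (S : set 'cV[R]_3)
    (a b : \bar R) (gamma : R -> 'cV[R]_3) : Prop :=
  rectifying_curve a b gamma /\ forall s, oitv a b s -> S (gamma s).

(* These conditions determine [Fs] on [U], since [phi_u], [phi_v] and
   [phi_u x phi_v] form a basis at each point of a regular patch. *)
Definition is_Fstar (R : realType) (F : 'cV[R]_3 -> 'cV[R]_3)
    (U : set (R * R)) (phi : R * R -> 'cV[R]_3) (Fs : R * R -> 'M[R]_3) :
    Prop :=
  forall p, U p ->
    [/\ (Fs p)^T *m Fs p = 1%:M,
        Fs p *m pdu phi p = pdu (F \o phi) p,
        Fs p *m pdv phi p = pdv (F \o phi) p &
        Fs p *m patch_normal phi p = patch_normal (F \o phi) p].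

(* Main.v *)
(** Let w = (u, v) and phibar = F o phi, which is smooth on U since it factors
    locally through patches of Sbar.  As phi is a homeomorphism onto an open part
    of S, w is continuous; composing phi at a given parameter with the linear forms
    dual to phi_u, phi_v yields a planar map whose differential there is the
    identity, so w is differentiable, and w' is a smooth function of w and gamma',
    whence w is as smooth as gamma.  Writing A = F_*(w) and gammabar = phibar o w,
    we get gammabar' = A gamma' (so gammabar has unit speed) and
    gammabar'' = A' gamma' + A gamma''.  Symmetry of the second derivatives of phi
    and phibar gives (dF_*/du) phi_v = (dF_*/dv) phi_u, so the bracket of the
    hypothesis is gammabar' x A' gamma'.  Finally A commutes with cross products,
    hence A gamma = lambda gammabar' + (mu/k) gammabar' x A gamma'', and the
    hypothesis becomes gammabar = lambda gammabar' + (mu/k) gammabar' x gammabar''. *)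

Require Import Defs.
From HB Require Import structures.
From mathcomp Require Import all_boot all_order all_algebra.
From mathcomp Require Import all_classical all_reals all_analysis.
From mathcomp Require Import ring lra.

Set Implicit Arguments.
Unset Strict Implicit.
Unset Printing Implicit Defensive.

Import Order.TTheory GRing.Theory Num.Theory.
Import numFieldNormedType.Exports.

Local Open Scope ring_scope.
Local Open Scope classical_set_scope.

(** * Calculus of the classes [Ck] *)

Section Ck_calculus.
Context {R : realType} {V : normedModType R}.
Implicit Types (W : normedModType R) (U : set V).

(** The first-order expansion of [f] at [x] is also one of [g], and such an expansion determines the
    differential. *)
Lemma near_eq_differentiable W (f g : V -> W) (x : V) :
  {near x, f =1 g} -> differentiable f x -> differentiable g x.
Proof.
move=> fg df; have [dfc fE] := (diff_locallyP _ _).1 df.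
have gE : g \o shift x = cst (g x) + 'd f x +o_0 id.
  apply/eqaddoP => _/posnumP[e].
  have := fE; move/eqaddoP => /(_ e%:num (gt0 e)).
  have fg0 : \forall h \near (0 : V), f (h + x) = g (h + x).
    by have := fg; rewrite (near_shift 0 x) /= ; apply: filterS => h /=; rewrite subr0.
  apply: filterS2 fg0 => h /= fgh.
  by rewrite !fctE /= fgh (nbhs_singleton fg).
have dgE : 'd g x = 'd f x :> (V -> W) by exact: diff_unique dfc gE.
by apply/diff_locallyP; split; rewrite dgE.
Qed.

Lemma open_near_eq W U (f g : V -> W) x :
  open U -> U x -> (forall y, U y -> f y = g y) -> {near x, f =1 g}.
Proof.
by move=> oU Ux fg; near=> y; apply: fg; near: y; exact: open_nbhs_nbhs.
Unshelve. all: by end_near. Qed.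

Lemma Ck_eq W n U (f g : V -> W) : open U -> (forall x, U x -> f x = g x) ->
  Ck n U f -> Ck n U g.
Proof.
move=> oU; elim: n f g => [|n IH] f g fg /=.
  move=> cf x Ux.
  have nfg : {near x, f =1 g} by exact: open_near_eq fg.
  have gf : g @ x --> f x by apply: cvg_trans (cf x Ux); exact: near_eq_cvg.
  by apply: cvg_trans gf _; rewrite fg.
case=> df Df; split=> /= [x Ux|v].
  exact: near_eq_differentiable (open_near_eq oU Ux fg) (df x Ux).
by apply: IH (Df v) => x Ux; apply: near_eq_derive; exact: open_near_eq fg.
Qed.

(** Each clause of [Ck] is a condition at single points of the set, with limits taken in the whole
    of [V], so the class can be checked point by point. *)
Lemma Ck_local W n U (f : V -> W) :
  (forall x, U x -> exists B, B x /\ Ck n B f) -> Ck n U f.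
Proof.
elim: n f => [|n IH] f /=.
  by move=> h x Ux; have [B [Ox cO]] := h x Ux; exact: cO.
move=> h; split=> [x Ux|v]; first by have [B [Ox [df _]]] := h x Ux; exact: df.
by apply: IH => x Ux; have [B [Ox [_ Df]]] := h x Ux; exists B.
Qed.

Lemma CkW W n U (f : V -> W) : Ck n.+1 U f -> Ck n U f.
Proof.
elim: n f => [|n IH] f [df Df]; first by move=> x /df /differentiable_continuous.
by split=> // v; exact: IH.
Qed.

Lemma Ck_le W m n U (f : V -> W) : (m <= n)%N -> Ck n U f -> Ck m U f.
Proof. by move=> /subnK <-; elim: (n - m)%N => // k IH /CkW. Qed.

Lemma Ck_cst W n U (c : W) : Ck n U (fun=> c).
Proof.
elim: n c => [|n IH] c /=; first by move=> x _; exact: cvg_cst.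
split=> [x _|v]; first exact: differentiable_cst.
by rewrite (_ : 'D_v _ = fun=> 0) //; apply/funext => x; rewrite derive_cst.
Qed.

Lemma CkD W n U (f g : V -> W) : open U -> Ck n U f -> Ck n U g ->
  Ck n U (fun x => f x + g x).
Proof.
move=> oU; elim: n f g => [|n IH] f g /=.
  by move=> cf cg x Ux; apply: cvgD; [exact: cf|exact: cg].
move=> [df Df] [dg Dg]; split=> /= [x Ux|v].
  by apply: differentiableD; [exact: df|exact: dg].
apply: Ck_eq (IH _ _ (Df v) (Dg v)) => // x Ux.
by rewrite (@deriveD _ _ _ f g) //; apply: diff_derivable; [exact: df|exact: dg].
Qed.

Lemma Ck_linear W W' n U (L : {linear W -> W'}) (f : V -> W) :
  open U -> continuous L -> Ck n U f -> Ck n U (fun x => L (f x)).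
Proof.
move=> oU cL; elim: n f => [|n IH] f /=.
  by move=> cf x Ux; apply: (cvg_comp _ _ (cf x Ux)); exact: cL.
case=> df Df; have dL y : differentiable L y by exact: linear_differentiable.
have dLf x : U x -> differentiable (L \o f) x.
  by move=> Ux; exact: differentiable_comp (df x Ux) (dL _).
split=> [x Ux|v]; first exact: dLf.
apply: Ck_eq (IH _ (Df v)) => // x Ux.
rewrite [RHS](deriveE v (dLf x Ux)) (diff_comp (df x Ux) (dL _)) /=.
by rewrite (diff_lin _ cL) deriveE //; exact: df.
Qed.

Lemma CkM n U (f g : V -> R) : open U -> Ck n U f -> Ck n U g ->
  Ck n U (fun x => f x * g x).
Proof.
move=> oU; elim: n f g => [|n IH] f g.
  by move=> cf cg x Ux; apply: cvgM; [exact: cf|exact: cg].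
move=> Cf Cg; have /= [df Df] := Cf; have /= [dg Dg] := Cg; split=> /= [x Ux|v].
  by apply: differentiableM; [exact: df|exact: dg].
have C := CkD oU (IH _ _ (CkW Cf) (Dg v)) (IH _ _ (CkW Cg) (Df v)).
apply: Ck_eq C => // x Ux.
by rewrite (@deriveM _ _ f g) //; apply: diff_derivable; [exact: df|exact: dg].
Qed.

Lemma CkN n U (f : V -> R) : open U -> Ck n U f -> Ck n U (fun x => - f x).
Proof.
move=> oU Cf; have C := CkM oU (Ck_cst n U (-1 : R)) Cf.
apply: Ck_eq C => // x _.
by rewrite mulN1r.
Qed.

Lemma CkB n U (f g : V -> R) : open U -> Ck n U f -> Ck n U g ->
  Ck n U (fun x => f x - g x).
Proof. by move=> oU Cf Cg; apply: CkD => //; exact: CkN. Qed.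

Lemma CkV n U (f : V -> R) : open U -> (forall x, U x -> f x != 0) ->
  Ck n U f -> Ck n U (fun x => (f x)^-1).
Proof.
move=> oU f0; elim: n f f0 => [|n IH] f f0.
  by move=> cf x Ux; apply: cvgV; [exact: f0|exact: cf].
move=> Cf; have /= [df Df] := Cf; split=> /= [x Ux|v].
  by apply: differentiableV; [exact: df|exact: f0].
have Ci := IH _ f0 (CkW Cf).
(* The derivative of [1/f] is [-(1/f)^2] times that of [f]; the induction hypothesis covers the
   factors [1/f]. *)
have C := CkM oU (CkN oU (CkM oU Ci Ci)) (Df v).
apply: Ck_eq C => // x Ux.
rewrite (@deriveV _ _ f) ?f0 //; last by apply: diff_derivable; exact: df.
by rewrite -invfM -expr2.
Qed.

Lemma Ck_sum n U (I : finType) (f : I -> V -> R) : open U ->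
  (forall i, Ck n U (f i)) -> Ck n U (fun x => \sum_i f i x).
Proof.
move=> oU Cf; rewrite unlock; elim: (index_enum I) => [|i r IH] /=.
  exact: Ck_cst.
by apply: CkD.
Qed.

(** Conversely to taking coordinates, [f] is the finite sum of its entries times the constant
    matrices [delta_mx i j]. *)
Lemma differentiable_mxP m k (f : V -> 'M[R]_(m, k)) x :
  differentiable f x <-> forall i j, differentiable (fun y => f y i j) x.
Proof.
split=> [df i j|df].
  exact: (differentiable_comp df (differentiable_coord _ i j)).
have -> : f = fun y => \sum_i \sum_j f y i j *: delta_mx i j.
  by apply/funext => y; exact: matrix_sum_delta.
have -> : (fun y => \sum_i \sum_j f y i j *: delta_mx i j) =
    \sum_i \sum_j (fun y => f y i j *: delta_mx i j) :> (V -> 'M[R]_(m, k)).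
  by apply/funext => y; rewrite fct_sumE; apply: eq_bigr => i _; rewrite fct_sumE.
apply: differentiable_sum => i; apply: differentiable_sum => j.
exact: differentiableZl.
Qed.

Lemma derive_mxE m k (f : V -> 'M[R]_(m, k)) x v i j : derivable f x v ->
  'D_v f x i j = 'D_v (fun y => f y i j) x.
Proof. by move=> df; rewrite derive_mx // mxE. Qed.

Lemma Ck_mxP m k n U (f : V -> 'M[R]_(m, k)) : open U ->
  Ck n U f <-> forall i j, Ck n U (fun x => f x i j).
Proof.
move=> oU; elim: n f => [|n IH] f /=.
  split=> [cf i j x Ux|cf x Ux].
    apply: (@cvg_comp _ _ _ f (fun N : 'M[R]_(m, k) => N i j) _ _ _ (cf x Ux)).
    exact: coord_continuous.
  (* The matrix norm is the maximum of the entries, so finitely many neighbourhoods, one for each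
     entry, are intersected. *)
  apply/cvgrPdist_lt => e e0; near=> y.
  rewrite /Num.Def.normr /= mx_normrE; apply/bigmax_ltP; split=> //= i _.
  rewrite !mxE /=; move: i; near: y.
  apply: filter_forall => /= i; exact: ((cvgrPdist_lt _ _).1 (cf i.1 i.2 x Ux) _ e0).
split=> [[df Df] i j|Cf].
  split=> [x Ux|v]; first by have /differentiable_mxP := df x Ux.
  apply: Ck_eq ((IH _).1 (Df v) i j) => // x Ux.
  by apply: derive_mxE; apply: diff_derivable; exact: df.
have df x : U x -> differentiable f x.
  by move=> Ux; apply/differentiable_mxP => i j; have [] := Cf i j => + _; apply.
split=> // v; apply/IH => i j; have [_ /(_ v)] := Cf i j; apply: Ck_eq => // x Ux.
by rewrite derive_mxE //; apply: diff_derivable; exact: df.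
Unshelve. all: by end_near. Qed.

End Ck_calculus.

(** * Composition with functions of two real variables, and the product rule for matrices *)

Section Ck_composition.
Context {R : realType} {V : normedModType R}.

Lemma derive_pair_dir {W : normedModType R} (g : R * R -> W) (p h : R * R) :
  differentiable g p -> 'D_h g p = h.1 *: pdu g p + h.2 *: pdv g p.
Proof.
move=> dg; rewrite /pdu /pdv !deriveE //.
have {1}-> : h = h.1 *: (1, 0) + h.2 *: (0, 1).
  by case: h => x y; congr pair; rewrite /= ?scaler0 ?addr0 ?add0r // [_ *: _]mulr1.
by rewrite linearD !linearZ.
Qed.

Lemma differentiable_comp2 {W : normedModType R} (g : R * R -> W) (f1 f2 : V -> R) x :
  differentiable f1 x -> differentiable f2 x -> differentiable g (f1 x, f2 x) ->
  differentiable (fun y => g (f1 y, f2 y)) x.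
Proof.
move=> d1 d2 dg.
exact: (differentiable_comp (differentiable_pair d1 d2) dg).
Qed.

Lemma derive_comp2 {W : normedModType R} (g : R * R -> W) (f1 f2 : V -> R) x v :
  differentiable f1 x -> differentiable f2 x -> differentiable g (f1 x, f2 x) ->
  'D_v (fun y => g (f1 y, f2 y)) x =
    'D_v f1 x *: pdu g (f1 x, f2 x) + 'D_v f2 x *: pdv g (f1 x, f2 x).
Proof.
move=> d1 d2 dg; have d12 := differentiable_pair d1 d2.
rewrite deriveE; last exact: (differentiable_comp d12 dg).
rewrite (_ : (fun y => _) = g \o (fun y => (f1 y, f2 y))) //.
rewrite (diff_comp d12 dg) /= -deriveE // (derive_pair_dir _ dg).
by rewrite (diff_pair d1 d2) /= !deriveE.
Qed.

(** By the chain rule each directional derivative is a sum of products of a derivative of [f1] or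
    [f2] with a partial derivative of [g] composed with [(f1, f2)], to which the induction
    hypothesis applies. *)
Lemma Ck_comp2 n (U : set V) (B : set (R * R)) (g : R * R -> R) (f1 f2 : V -> R) :
  open U -> (forall x, U x -> B (f1 x, f2 x)) ->
  Ck n B g -> Ck n U f1 -> Ck n U f2 -> Ck n U (fun x => g (f1 x, f2 x)).
Proof.
move=> oU UO; elim: n g => [|n IH] g.
  move=> cg c1 c2 x Ux.
  have c12 : (fun y => (f1 y, f2 y)) @ x --> (f1 x, f2 x).
    exact: cvg_pair (c1 x Ux) (c2 x Ux).
  exact: cvg_comp c12 (cg _ (UO x Ux)).
move=> Cg C1 C2; have /= [dg Dg] := Cg; have /= [d1 D1] := C1; have [d2 D2] := C2.
split=> [x Ux|v].
  by apply: differentiable_comp2; [exact: d1|exact: d2|exact/dg/UO].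
have C := CkD oU (CkM oU (D1 v) (IH _ (Dg (1, 0)) (CkW C1) (CkW C2)))
                 (CkM oU (D2 v) (IH _ (Dg (0, 1)) (CkW C1) (CkW C2))).
apply: Ck_eq C => // x Ux.
by rewrite derive_comp2 //; [exact: d1|exact: d2|exact/dg/UO].
Qed.

Lemma Ck_comp2_mx n m k (U : set V) (B : set (R * R)) (g : R * R -> 'M[R]_(m, k))
    (f1 f2 : V -> R) :
  open U -> open B -> (forall x, U x -> B (f1 x, f2 x)) ->
  Ck n B g -> Ck n U f1 -> Ck n U f2 -> Ck n U (fun x => g (f1 x, f2 x)).
Proof.
move=> oU oB UB /(Ck_mxP _ _ oB) Cg C1 C2; apply/Ck_mxP => // i j.
exact: Ck_comp2 (Cg i j) C1 C2.
Qed.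

Lemma derive_mulmx m n k (A : V -> 'M[R]_(m, n)) (f : V -> 'M[R]_(n, k)) x v :
  differentiable A x -> differentiable f x ->
  'D_v (fun y => A y *m f y) x = 'D_v A x *m f x + A x *m 'D_v f x.
Proof.
move=> dA df; have dAf : differentiable (fun y => A y *m f y) x.
  apply/differentiable_mxP => i j.
  have -> : (fun y => (A y *m f y) i j) =
      \sum_l (fun y => A y i l * f y l j) :> (V -> R).
    by apply/funext => y; rewrite mxE fct_sumE.
  apply: differentiable_sum => l; apply: differentiableM.
    exact: (differentiable_mxP A x).1.
  exact: (differentiable_mxP f x).1.
apply/matrixP => i j; rewrite derive_mxE; last exact: diff_derivable.
have -> : (fun y => (A y *m f y) i j) =
    \sum_l (fun y => A y i l * f y l j) :> (V -> R).
  by apply/funext => y; rewrite mxE fct_sumE.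
have dAi l : derivable (fun y => A y i l) x v.
  by apply: diff_derivable; exact: (differentiable_mxP A x).1.
have dfj l : derivable (fun y => f y l j) x v.
  by apply: diff_derivable; exact: (differentiable_mxP f x).1.
rewrite derive_sum; last by move=> l; exact: derivableM.
rewrite !mxE -big_split; apply: eq_bigr => l _ /=.
rewrite (@deriveM _ _ (fun y => A y i l) (fun y => f y l j)) //.
rewrite !derive_mxE; try exact: diff_derivable.
by rewrite addrC; congr (_ + _); exact: mulrC.
Qed.

End Ck_composition.

(** * Symmetry of second derivatives *)

Section mixed_derivatives.
Context {R : realType} {V : normedModType R}.

Lemma is_derive_line (f : V -> R) (c v : V) (s : R) :
  derivable f (s *: v + c) v ->
  is_derive s 1 (fun s : R => f (s *: v + c)) ('D_v f (s *: v + c)).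
Proof.
have E : (fun h : R => h^-1 *: (((fun s : R => f (s *: v + c)) \o shift s) (h *: 1)
    - f (s *: v + c))) =
    (fun h => h^-1 *: ((f \o shift (s *: v + c)) (h *: v) - f (s *: v + c))).
  by apply/funext => h /=; rewrite scalerDl addrA [h *: 1]mulr1.
by move=> df; split; rewrite /derivable /derive E.
Qed.

(** The mean value theorem is used twice: along [v] for the increment of [f] in the direction
    [h *: w], then along [w] for ['D_v f] at the value [s] found first. *)
Lemma second_difference (f : V -> R) (x v w : V) (h : R) : 0 < h ->
  (forall s t : R, 0 <= s <= h -> 0 <= t <= h ->
     derivable f (s *: v + (t *: w + x)) v /\
     derivable ('D_v f) (s *: v + (t *: w + x)) w) ->
  exists s t, [/\ 0 <= s <= h, 0 <= t <= h &
    f (h *: v + (h *: w + x)) - f (h *: v + x) - (f (h *: w + x) - f x)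
    = 'D_w ('D_v f) (s *: v + (t *: w + x)) * h ^+ 2].
Proof.
move=> h0 df; have hh : 0 <= h <= h by rewrite lexx ltW.
have z0 : 0 <= (0 : R) <= h by rewrite lexx ltW.
pose phi (s : R) : R := f (s *: v + (h *: w + x)) - f (s *: v + x).
have dphi s : 0 <= s <= h -> is_derive s 1 phi
    ('D_v f (s *: v + (h *: w + x)) - 'D_v f (s *: v + x)).
  move=> sh; apply: is_deriveB; apply: is_derive_line.
    by have [] := df s h sh hh.
  by have [+ _] := df s 0 sh z0; rewrite scale0r add0r.
have [||s] := @MVT _ phi (fun s => 'D_v f (s *: v + (h *: w + x)) - 'D_v f (s *: v + x)) 0 h h0.
- by move=> s; rewrite in_itv /= => /andP[s0 sh]; apply: dphi; rewrite !ltW.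
- apply: derivable_within_continuous => s; rewrite in_itv /= => sh.
  by have [] := dphi s sh.
rewrite in_itv /= => /andP[s0 sh] phiE.
have sh' : 0 <= s <= h by rewrite !ltW.
pose psi (t : R) : R := 'D_v f (t *: w + (s *: v + x)).
have dpsi t : 0 <= t <= h -> is_derive t 1 psi
    ('D_w ('D_v f) (t *: w + (s *: v + x))).
  move=> th; apply: is_derive_line.
  by have [_] := df s t sh' th; rewrite addrCA.
have [||t] := @MVT _ psi (fun t => 'D_w ('D_v f) (t *: w + (s *: v + x))) 0 h h0.
- by move=> t; rewrite in_itv /= => /andP[t0 th]; apply: dpsi; rewrite !ltW.
- apply: derivable_within_continuous => t; rewrite in_itv /= => th.
  by have [] := dpsi t th.
rewrite in_itv /= => /andP[t0 th] psiE.
exists s, t; split=> //; first by rewrite !ltW.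
rewrite [s *: v + (t *: w + x)]addrCA expr2 mulrA; rewrite subr0 in psiE phiE.
rewrite -psiE /psi scale0r add0r [h *: w + (s *: v + x)]addrCA -phiE /phi.
by rewrite scale0r !add0r.
Qed.

(** The two second differences are the same number with [B] and [C] exchanged, so [P = Q], and the
    triangle inequality through this common value gives the bound. Here [P], [Q] stand for the mixed
    derivatives at intermediate points and [p], [q] for those at the base point. *)
Lemma squeeze_swap (h e A B C D P Q p q : R) : 0 < h ->
  A - B - (C - D) = P * h ^+ 2 -> A - C - (B - D) = Q * h ^+ 2 ->
  `|p - P| < e / 2 -> `|q - Q| < e / 2 -> `|p - q| <= e.
Proof.
move=> h0 PE QE pP qQ; have PQ : P = Q.
  by apply: (@mulIf _ (h ^+ 2)); rewrite ?expf_neq0 ?gt_eqF // -PE -QE; ring.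
rewrite -PQ in qQ; rewrite -[p](subrK P) -addrA (splitr e) (le_trans (ler_normD _ _)) //.
by rewrite lerD ?(distrC P) // ltW.
Qed.

(** Schwarz's theorem. The second difference over a small parallelogram at [x] does not depend on
    the order of [v] and [w], and by continuity both mixed derivatives at [x] are close to its
    quotient by [h ^+ 2]. *)
Lemma derive_swap (U : set V) (f : V -> R) (x v w : V) : open U -> U x ->
  Ck 2 U f -> 'D_w ('D_v f) x = 'D_v ('D_w f) x.
Proof.
move=> oU Ux /= [df Df].
have c2 a b : {for x, continuous ('D_b ('D_a f))}.
  by have [_ /(_ b)] := Df a; apply.
apply/eqP; rewrite -subr_eq0 -normr_le0; apply/ler_addgt0Pr => e e0; rewrite add0r.
have e2 : 0 < e / 2 by rewrite divr_gt0.
have close a b : \forall y \near x,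
    `|'D_b ('D_a f) x - 'D_b ('D_a f) y| < e / 2.
  exact: (cvgrPdist_lt _ _).1 (c2 a b) _ e2.

have nU : nbhs x U by exact: open_nbhs_nbhs.
have nP := filterI nU (filterI (close v w) (close w v)).
have [d /= d0 dP] := (nbhs_normP _ _).1 (nP (nbhs_filter x) (nbhs_filter x)).
(* This [h] keeps the whole parallelogram with sides [h *: v] and [h *: w] within distance [d] of
   [x]; the summand 1 keeps the denominator positive when [v = w = 0]. *)
pose h := d / (`|v| + `|w| + 1).
have D0 : 0 < `|v| + `|w| + 1 by rewrite ltr_wpDl // addr_ge0.
have h0 : 0 < h by rewrite divr_gt0.
have inb s t : 0 <= s <= h -> 0 <= t <= h -> `|x - (s *: v + (t *: w + x))| < d.
  move=> /andP[s0 sh] /andP[t0 th].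
  rewrite addrA opprD addrCA subrr addr0 normrN (le_lt_trans (ler_normD _ _)) //.
  rewrite !normrZ !ger0_norm // (@le_lt_trans _ _ (h * `|v| + h * `|w|)) //.
    by rewrite lerD // ler_wpM2r.
  by rewrite -mulrDr /h mulrAC ltr_pdivrMr // ltr_pM2l // ltrDl.
have [|s [t [sh th E1]]] := @second_difference f x v w h h0.
  move=> s t sh th; have [Uy _] := dP _ (inb s t sh th).
  have [d1 _] := Df v; split; apply: diff_derivable; [exact: df|exact: d1].
have [|t' [s' [th' sh' E2]]] := @second_difference f x w v h h0.
  move=> t' s' th' sh'; rewrite addrCA; have [Uy _] := dP _ (inb _ _ sh' th').
  have [d1 _] := Df w; split; apply: diff_derivable; [exact: df|exact: d1].
have [_ [A1 _]] := dP _ (inb _ _ sh th).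
have [_ [_ A2]] := dP _ (inb _ _ sh' th').
rewrite [t' *: w + _]addrCA [h *: w + (h *: v + x)]addrCA in E2.
exact: squeeze_swap h0 E1 E2 A1 A2.
Qed.

Lemma derive_swap_mx m k (U : set V) (f : V -> 'M[R]_(m, k)) (x v w : V) :
  open U -> U x -> Ck 2 U f -> 'D_w ('D_v f) x = 'D_v ('D_w f) x.
Proof.
move=> oU Ux Cf; have [df Df] := Cf.
have E a b i j : 'D_b ('D_a f) x i j = 'D_b ('D_a (fun y => f y i j)) x.
  rewrite derive_mxE; last by apply: diff_derivable; have [+ _] := Df a; apply.
  apply: near_eq_derive; apply: open_near_eq oU Ux _ => y Uy.
  by rewrite derive_mxE //; apply: diff_derivable; exact: df.
apply/matrixP => i j.
have Cij := (Ck_mxP 2 f oU).1 Cf i j.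
have S := derive_swap v w oU Ux Cij.
by apply: etrans (E v w i j) (etrans S (esym (E w v i j))).
Qed.

End mixed_derivatives.

(** * Cross products and dual bases in three dimensions *)

Section vectors_in_space.
Context {R : realType}.
Implicit Types (a b c x y N : 'cV[R]_3) (A : 'M[R]_3).

Lemma big_ord3 (V : nmodType) (f : 'I_3 -> V) : \sum_i f i = f 0 + f 1 + f 2%:R.
Proof.
rewrite 3!big_ord_recl big_ord0 addr0 addrA.
by congr (_ + _ + _); congr f; apply: val_inj.
Qed.

Lemma ord3_ind (P : 'I_3 -> Prop) : P 0 -> P 1 -> P 2%:R -> forall i, P i.
Proof.
move=> P0 P1 P2 [[|[|[|//]]] lti].
- by rewrite (_ : Ordinal _ = 0) //; exact: val_inj.
- by rewrite (_ : Ordinal _ = 1) //; exact: val_inj.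
- by rewrite (_ : Ordinal _ = 2%:R) //; exact: val_inj.
Qed.

Lemma cV3P a b : a 0 0 = b 0 0 -> a 1 0 = b 1 0 -> a 2%:R 0 = b 2%:R 0 -> a = b.
Proof.
by move=> e0 e1 e2; apply/matrixP => i j; rewrite (ord1 j); elim/ord3_ind: i.
Qed.

Lemma crossmulE a b :
  ((a \cross b) 0 0 = a 1 0 * b 2%:R 0 - a 2%:R 0 * b 1 0) *
  ((a \cross b) 1 0 = a 2%:R 0 * b 0 0 - a 0 0 * b 2%:R 0) *
  ((a \cross b) 2%:R 0 = a 0 0 * b 1 0 - a 1 0 * b 0 0).
Proof.
rewrite /crossmul !mxE.
rewrite (_ : (0 : 'I_3) + 1 = 1); last exact: val_inj.
rewrite (_ : (0 : 'I_3) + 2%:R = 2%:R); last exact: val_inj.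
rewrite (_ : (1 : 'I_3) + 1 = 2%:R); last exact: val_inj.
rewrite (_ : (1 : 'I_3) + 2%:R = 0); last exact: val_inj.
rewrite (_ : (2%:R : 'I_3) + 1 = 0); last exact: val_inj.
by rewrite (_ : (2%:R : 'I_3) + 2%:R = 1); last exact: val_inj.
Qed.

(* [mxE] would unfold [crossmul], which these targeted rules leave alone. *)
Lemma coordZ (k : R) a i : (k *: a) i 0 = k * a i 0.
Proof. by rewrite mxE. Qed.

Lemma coordD a b i : (a + b) i 0 = a i 0 + b i 0.
Proof. by rewrite mxE. Qed.

Lemma coordN a i : (- a) i 0 = - a i 0.
Proof. by rewrite mxE. Qed.

Definition coordE := (coordZ, coordD, coordN).

Definition dotmul a b : R := \sum_i a i 0 * b i 0.

Lemma dotmulE a b :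
  dotmul a b = a 0 0 * b 0 0 + a 1 0 * b 1 0 + a 2%:R 0 * b 2%:R 0.
Proof. exact: big_ord3. Qed.

Lemma dotmul_eq0 a : (dotmul a a == 0) = (a == 0).
Proof.
apply/eqP/eqP => [/eqP|->]; last by rewrite /dotmul big1 // => i _; rewrite mxE mul0r.
rewrite /dotmul psumr_eq0 => [/allP a0|i _]; last exact: sqr_ge0.
apply/matrixP => i j; rewrite (ord1 j) mxE; apply/eqP.
by have := a0 i (mem_index_enum i); rewrite /= mulf_eq0 orbb.
Qed.

Lemma enormE a : enorm a = Num.sqrt (dotmul a a).
Proof. by []. Qed.

Lemma enorm_eq0 a : (enorm a == 0) = (a == 0).
Proof.
rewrite enormE sqrtr_eq0 le_eqVlt dotmul_eq0 ltNge.
by rewrite [0 <= _]sumr_ge0 ?orbF // => i _; exact: sqr_ge0.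
Qed.

Lemma dotmul_trmx a b : dotmul a b = (a^T *m b) 0 0.
Proof. by rewrite mxE; apply: eq_bigr => i _; rewrite [in RHS]mxE. Qed.

Lemma enorm_orthogonal A a : A^T *m A = 1%:M -> enorm (A *m a) = enorm a.
Proof.
move=> AA.
by rewrite !enormE !dotmul_trmx trmx_mul mulmxA -(mulmxA a^T) AA mulmx1.
Qed.

Lemma mulmx_cV3 A a i :
  (A *m a) i 0 = A i 0 * a 0 0 + A i 1 * a 1 0 + A i 2%:R * a 2%:R 0.
Proof. by rewrite mxE big_ord3. Qed.

Lemma crossmulZr (k : R) a b : a \cross (k *: b) = k *: (a \cross b).
Proof. by apply: cV3P; rewrite !(coordE, crossmulE); ring. Qed.

Lemma crossmulDr a b c : a \cross (b + c) = a \cross b + a \cross c.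
Proof. by apply: cV3P; rewrite !(coordE, crossmulE); ring. Qed.

(** This is the cofactor identity, and [d] is the determinant of [A], written out along the first
    row. *)
Lemma trmul_crossmul A : exists d, forall a b,
  A^T *m ((A *m a) \cross (A *m b)) = d *: (a \cross b).
Proof.
exists (A 0 0 * (A 1 1 * A 2%:R 2%:R - A 1 2%:R * A 2%:R 1)
  - A 0 1 * (A 1 0 * A 2%:R 2%:R - A 1 2%:R * A 2%:R 0)
  + A 0 2%:R * (A 1 0 * A 2%:R 1 - A 1 1 * A 2%:R 0)) => a b.
by apply: cV3P; rewrite mulmx_cV3 coordZ !crossmulE !mulmx_cV3 ![A^T _ _]mxE; ring.
Qed.

(* The determinant of [A] is 1, because [A] preserves one nonzero cross product. *)
Lemma crossmul_orthogonal A a b : A^T *m A = 1%:M -> a \cross b != 0 ->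
  A *m (a \cross b) = (A *m a) \cross (A *m b) ->
  forall x y, A *m (x \cross y) = (A *m x) \cross (A *m y).
Proof.
move=> AA ab0 Aab x y; have [d dE] := trmul_crossmul A.
have d1 : d = 1.
  apply/eqP; rewrite -subr_eq0; have : (d - 1) *: (a \cross b) = 0.
    by rewrite scalerBl scale1r -dE -Aab mulmxA AA mul1mx subrr.
  by move/eqP; rewrite scaler_eq0 (negPf ab0) orbF.
by rewrite -[x \cross y]scale1r -d1 -dE mulmxA (mulmx1C AA) mul1mx.
Qed.

Lemma dotmulZl (k : R) a b : dotmul (k *: a) b = k * dotmul a b.
Proof. by rewrite !dotmulE !coordE; ring. Qed.

Lemma dotmulZr (k : R) a b : dotmul a (k *: b) = k * dotmul a b.
Proof. by rewrite !dotmulE !coordE; ring. Qed.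

Lemma dotmulDr a b c : dotmul a (b + c) = dotmul a b + dotmul a c.
Proof. by rewrite !dotmulE !coordE; ring. Qed.

(* [dual1 a b], [dual2 a b] and [a x b / |a x b|^2] form the basis dual to
   [a], [b], [a x b]. *)
Definition dual1 a b := let N := a \cross b in (dotmul N N)^-1 *: (b \cross N).
Definition dual2 a b := let N := a \cross b in (dotmul N N)^-1 *: (N \cross a).

Lemma dotmul_dual a b : a \cross b != 0 ->
  [/\ dotmul (dual1 a b) a = 1, dotmul (dual1 a b) b = 0,
      dotmul (dual2 a b) a = 0 & dotmul (dual2 a b) b = 1].
Proof.
rewrite -dotmul_eq0 /dual1 /dual2 /= !dotmulZl; set n := dotmul _ _ => n0.
have [e1 e2 e3 e4] : [/\ dotmul (b \cross (a \cross b)) a = n,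
    dotmul (b \cross (a \cross b)) b = 0, dotmul ((a \cross b) \cross a) a = 0 &
    dotmul ((a \cross b) \cross a) b = n].
  by split; rewrite /n !dotmulE !crossmulE; ring.
by rewrite e1 e2 e3 e4 !mulr0 mulVf.
Qed.

(** After multiplication by [dotmul N N] both sides are polynomial in the coordinates. *)
Lemma dual_expansion a b (N := a \cross b) x : N != 0 ->
  x = dotmul (dual1 a b) x *: a + dotmul (dual2 a b) x *: b
      + ((dotmul N N)^-1 * dotmul N x) *: N.
Proof.
rewrite -dotmul_eq0 /dual1 /dual2 /= !dotmulZl -/N; set n := dotmul N N => n0.
apply: (scalerI n0); rewrite !scalerDr !scalerA !mulrA divff // !mul1r.
by apply: cV3P; rewrite !coordE /n /N !dotmulE !crossmulE; ring.
Qed.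

Lemma mulmx_delta (A : 'M[R]_3) i j : (A *m delta_mx j 0 : 'cV_3) i 0 = A i j.
Proof. by rewrite -colE mxE. Qed.

Lemma dotmul_delta (c : 'cV[R]_3) j : dotmul c (delta_mx j 0) = c j 0.
Proof.
by rewrite /dotmul (bigD1 j) //= mxE !eqxx mulr1 big1 ?addr0 // => i /negPf ij; rewrite mxE ij mulr0.
Qed.

(** Column [j] of [A] is the image of the [j]-th unit vector, which is expanded in the basis [a],
    [b], [a \cross b]. The formula serves to read off the regularity of the entries of [F_*]. *)
Lemma mulmx_dual A a b a' b' N' i j : a \cross b != 0 ->
  A *m a = a' -> A *m b = b' -> A *m (a \cross b) = N' ->
  A i j = dual1 a b j 0 * a' i 0 + dual2 a b j 0 * b' i 0 +
    (dotmul (a \cross b) (a \cross b))^-1 * (a \cross b) j 0 * N' i 0.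
Proof.
move=> N0 <- <- <-.
rewrite -[LHS]mulmx_delta [in LHS](dual_expansion (delta_mx j 0) N0).
rewrite !mulmxDr -!scalemxAr !dotmul_delta !coordD.
by congr (_ + _ + _); rewrite coordZ.
Qed.

End vectors_in_space.

(** * Patches, lifts of curves and the matrix [F_*] *)

Section lifting.
Context {R : realType}.

(** With [D] the increment of [w] and [L] the differential of [q \o w], comparing the two expansions
    of [q (w (h + x))] gives [D = L h + o(h) + o(D)]. The term [o(D)] is absorbed on the left, which
    bounds [D] by a multiple of [h] and leaves [D = L h + o(h)]. *)
Lemma differentiable_lift (X E : normedModType R) (q : E -> E) (w : X -> E) (x : X) :
  {for x, continuous w} -> differentiable q (w x) ->
  'd q (w x) = id :> (E -> E) ->
  differentiable (q \o w) x -> differentiable w x.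
Proof.
move=> cw dq dqid dqw.
have [dc cE] := (diff_locallyP _ _).1 dqw.
set L := 'd (q \o w) x in dc cE.
have [K K0 LK] := linear_lipschitz dc.
suff wE : w \o shift x = cst (w x) + L +o_0 id.
  have dwE : 'd w x = L :> (X -> E) by exact: diff_unique dc wE.
  by apply/diff_locallyP; split; rewrite dwE.
apply/eqaddoP => e e0.
have K2 : 0 < 2 + 2 * K by rewrite ltr_wpDr // mulr_ge0 // ltW.
(* The bound [1 / 2] lets [eta * |D|] be absorbed, whence [|D| <= (1 + 2 * K) * |h|]; the other
   bound then makes the total error [eta * (2 + 2 * K) * |h|] at most [e * |h|]. *)
pose eta := Num.min (1 / 2) (e / (2 + 2 * K)).
have eta0 : 0 < eta by rewrite lt_min !divr_gt0.
have n1 : \forall h \near (0 : X), `|q (w (h + x)) - (q (w x) + L h)| <= eta * `|h|.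
  have /eqaddoP /(_ eta eta0) := cE.
  by apply: filterS => h; rewrite !fctE.
have n2 : \forall p \near (w x), `|q p - (q (w x) + (p - w x))| <= eta * `|p - w x|.
  have [_ /eqaddoP /(_ eta eta0)] := (diff_locallyP _ _).1 dq.
  rewrite (near_shift 0 (w x)) /=; apply: filterS => h; rewrite !fctE /= dqid subr0 addrK.
  by [].
(* Continuity of [w] at [x] turns the estimate for points near [w x] into one for small increments
   [h]. *)
have n3 : \forall h \near (0 : X),
    `|q (w (h + x)) - (q (w x) + (w (h + x) - w x))| <= eta * `|w (h + x) - w x|.
  have : \forall y \near x,
      `|q (w y) - (q (w x) + (w y - w x))| <= eta * `|w y - w x| by exact: cw _ n2.
  by rewrite (near_shift 0 x) /=; apply: filterS => h; rewrite /= subr0.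
apply: filterS2 n1 n3 => h; rewrite !fctE /= => h1 h3.
set D := w (h + x) - w x in h3 *.
have DL : `|D - L h| <= eta * `|h| + eta * `|D|.
  have -> : D - L h = (q (w (h + x)) - (q (w x) + L h)) - (q (w (h + x)) - (q (w x) + D)).
    by rewrite (opprB (q _)) [RHS]addrC addrA subrK opprD addrACA subrr add0r.
  by rewrite (le_trans (ler_normB _ _)) // lerD.
have eta1 : eta <= 1 / 2 by rewrite ge_min lexx.
have eta2 : eta * (2 + 2 * K) <= e by rewrite -ler_pdivlMr // ge_min lexx orbT.
have Lh := LK h.
have D1 : `|D| <= `|D - L h| + `|L h| by rewrite -{1}(subrK (L h) D) ler_normD.
have -> : w (h + x) - (w x + L h) = D - L h by rewrite /D opprD addrA.
have h0 := normr_ge0 h; have D0 := normr_ge0 D.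
have D2 : `|D| <= (1 + 2 * K) * `|h|.
  have := ler_wpM2r D0 eta1; have := ler_wpM2r h0 eta1.
  move: DL D1 Lh; clear; move: `|D| `|h| `|L h| `|D - L h| => d hh l dl; nra.
have D3 : eta * `|D| <= eta * ((1 + 2 * K) * `|h|) by rewrite ler_wpM2l // ltW.
have D4 := ler_wpM2r h0 eta2.
move: DL D3 D4; clear; move: `|D| `|h| `|L h| `|D - L h| => d hh l dl; nra.
Qed.

End lifting.

(** * Regularity of dot and cross products *)

Section differentiation_in_space.
Context {R : realType} {V : normedModType R}.
Implicit Types (f g : V -> 'cV[R]_3) (U : set V).

Lemma Ck_dotmul n U f g : open U -> Ck n U f -> Ck n U g ->
  Ck n U (fun x => dotmul (f x) (g x)).
Proof.
move=> oU /(Ck_mxP _ _ oU) Cf /(Ck_mxP _ _ oU) Cg; rewrite /dotmul.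
by apply: Ck_sum => // i; apply: CkM.
Qed.

Lemma Ck_crossmul n U f g : open U -> Ck n U f -> Ck n U g ->
  Ck n U (fun x => f x \cross g x).
Proof.
move=> oU /(Ck_mxP _ _ oU) Cf /(Ck_mxP _ _ oU) Cg; apply/Ck_mxP => // i j.
rewrite (ord1 j) (_ : (fun x => _) = fun x =>
  f x (i + 1) 0 * g x (i + 2%:R) 0 - f x (i + 2%:R) 0 * g x (i + 1) 0); last first.
  by apply/funext => x; rewrite mxE.
by apply: CkB => //; apply: CkM.
Qed.

Lemma Ck_scale n U (k : V -> R) f : open U -> Ck n U k -> Ck n U f ->
  Ck n U (fun x => k x *: f x).
Proof.
move=> oU Ck_k /(Ck_mxP _ _ oU) Cf; apply/Ck_mxP => // i j.
rewrite (_ : (fun x => _) = fun x => k x * f x i j); first exact: CkM.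
by apply/funext => x; rewrite mxE.
Qed.

Lemma derive_dotmul (c : 'cV[R]_3) f x v : differentiable f x ->
  differentiable (fun y => dotmul c (f y)) x /\
  'D_v (fun y => dotmul c (f y)) x = dotmul c ('D_v f x).
Proof.
move=> df.
have E : (fun y => dotmul c (f y)) = \sum_i (c i 0 *: (fun y => f y i 0)) :> (V -> R).
  by apply/funext => y; rewrite fct_sumE.
have di i := (differentiable_mxP f x).1 df i 0.
rewrite E; split; first by apply: differentiable_sum => i; exact: differentiableZ.
rewrite derive_sum; last by move=> i; apply: derivableZ; exact: diff_derivable.
apply: eq_bigr => i _; rewrite deriveZ; last exact: diff_derivable.
by rewrite -derive_mxE //; exact: diff_derivable.
Qed.

End differentiation_in_space.

(** * Smoothness of [F \o phi] *)

Section patches.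
Context {R : realType}.
Implicit Types (S T : set 'cV[R]_3) (U : set (R * R)) (phi : R * R -> 'cV[R]_3).

Lemma regular_patch_in S U phi p : regular_patch S U phi -> U p -> S (phi p).
Proof. by move=> [_ _ _ [W [_ [[+ _ _] _ _]]]] Up => /(_ _ Up) []. Qed.

Lemma within_cvg_comp (X Y Z : topologicalType) (A : set Y) (f : X -> Y) (g : Y -> Z) x :
  {within A, continuous g} -> {for x, continuous f} ->
  A (f x) -> (\forall y \near x, A (f y)) -> {for x, continuous (g \o f)}.
Proof.
move=> /subspace_continuousP cg cf Afx Af P nP.
have n1 : \forall y \near x, A (f y) -> P (g (f y)) by exact: cf _ (cg _ Afx _ nP).
by apply: filterS2 Af n1 => y Afy; exact.
Qed.

Lemma Ck_pdu n U (W : normedModType R) (f : R * R -> W) : Ck n.+1 U f -> Ck n U (pdu f).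
Proof. by move=> [_]; exact. Qed.

Lemma Ck_pdv n U (W : normedModType R) (f : R * R -> W) : Ck n.+1 U f -> Ck n U (pdv f).
Proof. by move=> [_]; exact. Qed.

Lemma Ck_patch_normal n U phi : open U -> Ck n.+1 U phi -> Ck n U (patch_normal phi).
Proof.
by move=> oU C; apply: Ck_crossmul => //; [exact: Ck_pdu|exact: Ck_pdv].
Qed.

(* [phi] followed by [F] factors locally through a patch of the target. *)
Lemma smooth_map_patch S T F U phi : smooth_surface T -> smooth_map S T F ->
  regular_patch S U phi -> smooth_on U (F \o phi).
Proof.
move=> sT [ST cF sF] rphi n; have [oU sphi _ _] := rphi.
apply: Ck_local => p Up.
have Sphi q : U q -> S (phi q) by exact: regular_patch_in rphi.
have [V0 [psi [rpsi psip]]] := sT _ (ST _ (Sphi p Up)).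
have [oV spsi _ [W [oW [[psiVW _ VWpsi] _ [g [psiK _]]]]]] := rpsi.
pose B := U `&` (F \o phi) @^-1` (psi @` V0).
have BE q : U q -> W (F (phi q)) -> (psi @` V0) (F (phi q)).
  by move=> Uq Wq; apply: VWpsi; split=> //; exact/ST/Sphi.
(* On the target surface the image of [psi] is cut out by the open set [W], so [B] consists of the
   points of [U] that the continuous map [F \o phi] sends into [W]. *)
have oB : open B.
  rewrite openE => q [Uq Bq].
  have nU : nbhs q U by exact: open_nbhs_nbhs.
  have Wq : W (F (phi q)) by have [z Vz /= <-] := Bq; have [] := psiVW _ Vz.
  have cFphi : {for q, continuous (F \o phi)}.
    apply: within_cvg_comp cF _ (Sphi _ Uq) _; first exact: (sphi 0%N).
    by apply: filterS nU => r; exact: Sphi.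
  have nW : \forall r \near q, W (F (phi r)).
    by apply: cFphi; exact: open_nbhs_nbhs.
  by apply: filterS2 nU nW => r Ur Wr; split=> //; exact: BE.
exists B; split; first by split.
have sh := sF _ _ _ _ _ rphi rpsi psiK; rewrite -/B in sh.
(* [h] is [F] read in the two patches, and [F \o phi] is [psi \o h] on [B]. *)
set h := g \o F \o phi in sh.
have psih q : B q -> V0 (h q) /\ psi (h q) = F (phi q).
  by move=> [Uq [z Vz /= zE]]; rewrite /h /= -zE psiK //; exact: mem_set.
have Cfst : Ck n B (fun q => (h q).1).
  by apply: (@Ck_linear _ _ _ _ n B fst h oB) (sh n) => z; exact: cvg_fst.
have Csnd : Ck n B (fun q => (h q).2).
  by apply: (@Ck_linear _ _ _ _ n B snd h oB) (sh n) => z; exact: cvg_snd.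
have C : Ck n B (fun q => psi ((h q).1, (h q).2)).
  apply: Ck_comp2_mx oB oV _ (spsi n) Cfst Csnd => q Bq.
  by rewrite -surjective_pairing; have [] := psih q Bq.
apply: Ck_eq oB _ C => q Bq.
by rewrite -surjective_pairing; have [] := psih q Bq.
Qed.

End patches.

(** * Differentiability of the parameters of a curve in a patch *)

Section lifting_curves.
Context {R : realType}.
Implicit Types (S : set 'cV[R]_3) (U : set (R * R)) (phi : R * R -> 'cV[R]_3).

(** Near [s] the parameters are [g \o gamma], where [g] is the inverse of [phi], continuous on the
    image of the patch. *)
Lemma continuous_lift S U phi (I : set R) (gamma : R -> 'cV[R]_3) (u v : R -> R) s :
  regular_patch S U phi -> open I -> I s -> {for s, continuous gamma} ->
  (forall s, I s -> U (u s, v s) /\ gamma s = phi (u s, v s)) ->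
  {for s, continuous (fun s => (u s, v s))}.
Proof.
move=> rphi oI Is cgamma gE; have [_ _ _ [W [_ [[phiUW _ _] _ [g [phiK cg]]]]]] := rphi.
have gammaW r : I r -> (S `&` W) (gamma r).
  by move=> /gE[Ur ->]; exact: phiUW.
have nI : nbhs s I by exact: open_nbhs_nbhs.
have c : {for s, continuous (g \o gamma)}.
  apply: within_cvg_comp cg cgamma (gammaW _ Is) _.
  by apply: filterS nI => r; exact: gammaW.
have wE r : I r -> (u r, v r) = g (gamma r).
  by move=> /gE[Ur ->]; rewrite phiK //; exact: mem_set.
have E : {near s, g \o gamma =1 (fun s => (u s, v s))}.
  by apply: filterS nI => r Ir /=; rewrite wE.
have gc : (fun s => (u s, v s)) @ s --> g (gamma s).
  by apply: cvg_trans c; exact: near_eq_cvg.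
by apply: cvg_trans gc _; rewrite wE.
Qed.

Lemma dotmul_comb (c a b : 'cV[R]_3) (x y : R) :
  dotmul c (x *: a + y *: b) = x * dotmul c a + y * dotmul c b.
Proof. by rewrite dotmulDr !dotmulZr. Qed.

Lemma derive_dotmul_pair (c : 'cV[R]_3) phi p h : differentiable phi p ->
  'D_h (fun r => dotmul c (phi r)) p =
    h.1 * dotmul c (pdu phi p) + h.2 * dotmul c (pdv phi p).
Proof.
move=> dphi; have [_ ->] := derive_dotmul c h dphi.
by rewrite (derive_pair_dir _ dphi); exact: dotmul_comb.
Qed.

(** The dual vectors are frozen at [p], so the partial derivatives of [q] at [p] are their pairings
    with [a] and [b], which form the identity matrix. *)
Lemma diff_dotmul_dual phi p (a := pdu phi p) (b := pdv phi p)
    (q := fun r => (dotmul (dual1 a b) (phi r), dotmul (dual2 a b) (phi r))) :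
  differentiable phi p -> patch_normal phi p != 0 ->
  differentiable q p /\ 'd q p = id :> (R * R -> R * R).
Proof.
move=> dphi N0; have [e11 e12 e21 e22] := dotmul_dual N0.
have dq c : differentiable (fun r => dotmul c (phi r)) p.
  by have [] := derive_dotmul c 0 dphi.
split; first exact: differentiable_pair.
apply/funext => h.
have E c k l : dotmul c a = k -> dotmul c b = l ->
    'd (fun r => dotmul c (phi r)) p h = h.1 * k + h.2 * l.
  by move=> <- <-; rewrite -(deriveE h (dq c)); exact: derive_dotmul_pair.
rewrite (diff_pair (dq _) (dq _)).
apply: etrans (congr2 pair (E _ _ _ e11 e12) (E _ _ _ e21 e22)) _.
by rewrite !mulr0 !mulr1 addr0 add0r; case: h {E}.
Qed.

Lemma differentiable_lift_patch phi (u v : R -> R) s :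
  {for s, continuous (fun s => (u s, v s))} ->
  differentiable phi (u s, v s) -> patch_normal phi (u s, v s) != 0 ->
  differentiable (fun s => phi (u s, v s)) s ->
  differentiable u s /\ differentiable v s.
Proof.
move=> cw dphi N0 dg; have [dq qid] := diff_dotmul_dual dphi N0.
set q := fun r => _ in dq qid.
have dqw : differentiable (q \o (fun s => (u s, v s))) s.
  have dqc c := derive_dotmul c 0 dg.
  exact: differentiable_pair (dqc _).1 (dqc _).1.
have dw := differentiable_lift cw dq qid dqw.
have dfst r : differentiable (fst : R * R -> R) r.
  by apply: linear_differentiable => z; exact: cvg_fst.
have dsnd r : differentiable (snd : R * R -> R) r.
  by apply: linear_differentiable => z; exact: cvg_snd.
by split; [exact: differentiable_comp dw (dfst _)|exact: differentiable_comp dw (dsnd _)].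
Qed.

(** On the line the derivative in a direction [h] is [h] times the ordinary one. *)
Lemma Ck_derive1 (W : normedModType R) n (I : set R) (f : R -> W) : open I ->
  (forall s, I s -> differentiable f s) -> Ck n I (derive1 f) -> Ck n.+1 I f.
Proof.
move=> oI df Cf; split=> // h.
have C : Ck n I (fun s => h *: derive1 f s).
  apply: (@Ck_linear _ _ _ _ n I ( *:%R h) (derive1 f) oI _ Cf) => x.
  exact: scaler_continuous.
apply: Ck_eq oI _ C => s Is; rewrite derive1E !deriveE; try exact: df.
by rewrite -{2}[h]mulr1 -[h * 1]/(h *: 1) linearZ.
Qed.

Lemma derive1_Ck (W : normedModType R) n (I : set R) (f : R -> W) :
  Ck n.+1 I f -> Ck n I (derive1 f).
Proof.
move=> [_ /(_ 1)]; rewrite (_ : derive1 f = 'D_1 f) //.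
by apply/funext => s; rewrite derive1E.
Qed.

End lifting_curves.

(** * Higher regularity of the parameters and of [F_*] *)

Section regularity.
Context {R : realType}.
Implicit Types (S : set 'cV[R]_3) (U : set (R * R)) (phi : R * R -> 'cV[R]_3).

Lemma Ck_dual (V : normedModType R) n (U : set V) (f g : V -> 'cV[R]_3) : open U ->
  (forall x, U x -> f x \cross g x != 0) -> Ck n U f -> Ck n U g ->
  Ck n U (fun x => dual1 (f x) (g x)) /\ Ck n U (fun x => dual2 (f x) (g x)).
Proof.
move=> oU N0 Cf Cg; have CN := Ck_crossmul oU Cf Cg.
have Cn : Ck n U (fun x => (dotmul (f x \cross g x) (f x \cross g x))^-1).
  apply: CkV => //; last exact: Ck_dotmul.
  by move=> x Ux; rewrite dotmul_eq0 N0.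
by split; apply: Ck_scale => //; apply: Ck_crossmul.
Qed.

Lemma Ck_lift S U phi (I : set R) (gamma : R -> 'cV[R]_3) (u v : R -> R) n :
  regular_patch S U phi -> open I -> Ck n.+1 I gamma ->
  (forall s, I s -> U (u s, v s) /\ gamma s = phi (u s, v s)) ->
  Ck n.+1 I u /\ Ck n.+1 I v.
Proof.
move=> rphi oI Cgamma gE; have [oU sphi N0 _] := rphi.
have [dgamma _] := Cgamma; have [dphi _] := sphi 1%N.
have Uw s : I s -> U (u s, v s) by move=> /gE[].
have near_gE s : I s -> {near s, gamma =1 (fun s => phi (u s, v s))}.
  by move=> Is; apply: open_near_eq oI Is _ => r /gE[].
have duv s : I s -> differentiable u s /\ differentiable v s.
  move=> Is; apply: (@differentiable_lift_patch _ phi).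
  - apply: (continuous_lift rphi oI Is _ gE).
    exact: differentiable_continuous (dgamma s Is).
  - exact/dphi/Uw.
  - exact/N0/Uw.
  - exact: near_eq_differentiable (near_gE s Is) (dgamma s Is).
have derE s : I s -> derive1 gamma s =
    derive1 u s *: pdu phi (u s, v s) + derive1 v s *: pdv phi (u s, v s).
  move=> Is; have [du dv] := duv s Is; rewrite !derive1E.
  rewrite (near_eq_derive _ (near_gE s Is)).
  exact: derive_comp2 du dv (dphi _ (Uw s Is)).
pose th1 p := dual1 (pdu phi p) (pdv phi p).
pose th2 p := dual2 (pdu phi p) (pdv phi p).
(* Pairing the velocity with the dual basis isolates its two components [u'] and [v']. *)
have dE s : I s -> dotmul (th1 (u s, v s)) (derive1 gamma s) = derive1 u s /\
    dotmul (th2 (u s, v s)) (derive1 gamma s) = derive1 v s.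
  move=> Is; have [e11 e12 e21 e22] := dotmul_dual (N0 _ (Uw s Is)).
  have E c k l : dotmul c (pdu phi (u s, v s)) = k ->
      dotmul c (pdv phi (u s, v s)) = l ->
      dotmul c (derive1 gamma s) = derive1 u s * k + derive1 v s * l.
    by move=> <- <-; rewrite derE //; exact: dotmul_comb.
  by rewrite (E _ _ _ e11 e12) (E _ _ _ e21 e22) !mulr0 !mulr1 addr0 add0r.
have Cth m : Ck m U th1 /\ Ck m U th2.
  apply: Ck_dual => //; [exact/Ck_pdu/sphi|exact/Ck_pdv/sphi].
have Cgamma' := derive1_Ck Cgamma.
(* Bootstrap: if [u] and [v] are of class m with [m <= n], the formulas for [u'] and [v'] are of
   class m, so [u] and [v] are of class m + 1. It ends at [n.+1] because [gamma'] is of class n. *)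
suff H m : (m <= n.+1)%N -> Ck m I u /\ Ck m I v by exact: H.
elim: m => [_|m IH mn].
  by split=> s /duv[du dv]; exact: differentiable_continuous.
have [Cu Cv] := IH (ltnW mn); have [C1 C2] := Cth m.
have Cg := Ck_le (mn : (m <= n)%N) Cgamma'.
have D1 := Ck_dotmul oI (Ck_comp2_mx oI oU Uw C1 Cu Cv) Cg.
have D2 := Ck_dotmul oI (Ck_comp2_mx oI oU Uw C2 Cu Cv) Cg.
split; apply: Ck_derive1 => //; try by move=> s /duv[].
  by apply: Ck_eq oI _ D1 => s /dE[].
by apply: Ck_eq oI _ D2 => s /dE[].
Qed.

Lemma smooth_Fstar S U phi F Fs : regular_patch S U phi -> smooth_on U (F \o phi) ->
  is_Fstar F U phi Fs -> smooth_on U Fs.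
Proof.
move=> rphi sFphi FsE n; have [oU sphi N0 _] := rphi.
pose th1 p := dual1 (pdu phi p) (pdv phi p).
pose th2 p := dual2 (pdu phi p) (pdv phi p).
pose N := patch_normal phi; pose nb := patch_normal (F \o phi).
have [C1 C2] : Ck n U th1 /\ Ck n U th2.
  by apply: Ck_dual => //; [exact/Ck_pdu/sphi|exact/Ck_pdv/sphi].
have /(Ck_mxP _ _ oU) CN := Ck_patch_normal oU (sphi n.+1).
have /(Ck_mxP _ _ oU) Cnb := Ck_patch_normal oU (sFphi n.+1).
have /(Ck_mxP _ _ oU) Ca := Ck_pdu (sFphi n.+1).
have /(Ck_mxP _ _ oU) Cb := Ck_pdv (sFphi n.+1).
have Cn : Ck n U (fun p => (dotmul (N p) (N p))^-1).
  apply: CkV => //; first by move=> p Up; rewrite dotmul_eq0 N0.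
  by apply: Ck_dotmul => //; exact: Ck_patch_normal.
move/(Ck_mxP _ _ oU): C1 => C1; move/(Ck_mxP _ _ oU): C2 => C2.
apply/Ck_mxP => // i j.
have C := CkD oU (CkD oU (CkM oU (C1 j 0) (Ca i 0)) (CkM oU (C2 j 0) (Cb i 0)))
  (CkM oU (CkM oU Cn (CN j 0)) (Cnb i 0)).
apply: Ck_eq oU _ C => p Up; have [_ Fa Fb FN] := FsE p Up.
by rewrite (mulmx_dual i j (N0 p Up) Fa Fb FN).
Qed.

End regularity.

(** * Rectifying curves *)

Lemma open_oitv (R : realType) (a b : \bar R) : open (oitv a b).
Proof. by apply: openI; [exact: open_ereal_gt|exact: open_ereal_lt]. Qed.

Lemma mulmx_comb (R : comNzRingType) n (A : 'M[R]_n) (x y : R) (a b a' b' : 'cV[R]_n) :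
  A *m a = a' -> A *m b = b' -> A *m (x *: a + y *: b) = x *: a' + y *: b'.
Proof. by move=> <- <-; rewrite mulmxDr -!scalemxAr. Qed.

(** The algebra at one parameter value: [A], [Au], [Av] are [F_*] and its partial derivatives, [a]
    and [b] are [phi_u] and [phi_v], [T] and [T2] are the first two derivatives of [gamma], and
    [T2b] is the second derivative of its image. *)
Lemma image_position (R : realType) (A Au Av : 'M[R]_3) (a b g gb T2 : 'cV[R]_3)
    (du dv l m k : R) (T := du *: a + dv *: b) (T2b := (du *: Au + dv *: Av) *m T + A *m T2) :
  A^T *m A = 1%:M -> a \cross b != 0 ->
  A *m (a \cross b) = (A *m a) \cross (A *m b) -> Au *m b = Av *m a ->
  g = l *: T + m *: (T \cross (k^-1 *: T2)) ->
  gb - A *m g = (m / k) *: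
      (du ^+ 3 *: ((A *m a) \cross (Au *m a))
       + (2 * du ^+ 2 * dv) *: ((A *m a) \cross (Au *m b))
       + (du * dv ^+ 2) *: ((A *m a) \cross (Av *m b))
       + (du ^+ 2 * dv) *: ((A *m b) \cross (Au *m a))
       + (2 * du * dv ^+ 2) *: ((A *m b) \cross (Au *m b))
       + dv ^+ 3 *: ((A *m b) \cross (Av *m b))) ->
  gb = l *: (A *m T) + (m / k) *: ((A *m T) \cross T2b).
Proof.
move=> AA N0 Aab Auv gE; set X := (X in _ = _ *: X) => gbE.
have AX := crossmul_orthogonal AA N0 Aab.
(* Expanding the right side gives [Au *m b] and [Av *m a] with equal weights; their equality
   produces the two coefficients 2 of the bracket. *)
have XE : X = (A *m T) \cross ((du *: Au + dv *: Av) *m T).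
  rewrite /X /T !mulmxDr !mulmxDl -!scalemxAr -!scalemxAl -Auv.
  move: (A *m a) (A *m b) (Au *m a) (Au *m b) (Av *m b) => x y z w t; clear.
  by apply: cV3P; rewrite !(coordE, crossmulE); ring.
rewrite /T2b crossmulDr -XE -AX scalerDr -gbE.
have -> : A *m g = l *: (A *m T) + (m / k) *: (A *m (T \cross T2)).
  by rewrite gE mulmxDr crossmulZr !scalerA -!scalemxAr.
by rewrite opprD (addrA gb) subrK [RHS]addrC subrK.
Qed.

Theorem theorem4p1 (R : realType) (S Sbar : set 'cV[R]_3)
  (F : 'cV[R]_3 -> 'cV[R]_3)
  (U : set (R * R)) (phi : R * R -> 'cV[R]_3) (Fs : R * R -> 'M[R]_3)
  (a b : \bar R) (gamma : R -> 'cV[R]_3) (u v lambda mu : R -> R) :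
  smooth_surface S -> smooth_surface Sbar -> surface_isometry S Sbar F ->
  regular_patch S U phi ->
  is_Fstar F U phi Fs ->
  rectifying_curve_on S a b gamma ->
  (forall s, oitv a b s -> U (u s, v s) /\ gamma s = phi (u s, v s)) ->
  (forall s, oitv a b s ->
    gamma s = lambda s *: tangent gamma s + mu s *: binormal gamma s) ->
  (forall s, oitv a b s -> derive1 (derive1 (F \o gamma)) s != 0) ->
  (forall s, oitv a b s ->
    let p := (u s, v s) in
    let u' := derive1 u s in
    let v' := derive1 v s in
    let A := Fs p in
    let Au := pdu Fs p in
    let Av := pdv Fs p in
    let phiu := pdu phi p in
    let phiv := pdv phi p in
    (F \o gamma) s - A *m gamma s =
    (mu s / curvature gamma s) *:
      (u' ^+ 3 *: ((A *m phiu) \cross (Au *m phiu))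
       + (2 * u' ^+ 2 * v') *: ((A *m phiu) \cross (Au *m phiv))
       + (u' * v' ^+ 2) *: ((A *m phiu) \cross (Av *m phiv))
       + (u' ^+ 2 * v') *: ((A *m phiv) \cross (Au *m phiu))
       + (2 * u' * v' ^+ 2) *: ((A *m phiv) \cross (Au *m phiv))
       + v' ^+ 3 *: ((A *m phiv) \cross (Av *m phiv)))) ->
  rectifying_curve_on Sbar a b (F \o gamma).
Proof.
move=> _ sSbar [[G [sF _ _ _]] _] rphi FsE [[[Cgamma unit_gamma] _] gammaS] wE gammaE
  acc0 posE.
have [oU sphi N0 _] := rphi; have [FS _ _] := sF.
have sphib := smooth_map_patch sSbar sF rphi.
have sFs := smooth_Fstar rphi sphib FsE.
have oI := @open_oitv R a b; set I := oitv a b in oI *.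
have [Cu Cv] := Ck_lift rphi oI Cgamma wE.
have Uw s : I s -> U (u s, v s) by move=> /wE[].
have gammabE s : I s -> (F \o gamma) s = (F \o phi) (u s, v s).
  by move=> /wE[_ /= ->].
have Cgammab : Ck 4 I (F \o gamma).
  have C := Ck_comp2_mx oI oU Uw (sphib 4%N) Cu Cv.
  by apply: Ck_eq oI _ C => s /gammabE.
have duE s : I s -> differentiable u s by have [+ _] := Cu; apply.
have dvE s : I s -> differentiable v s by have [+ _] := Cv; apply.
have velE (f : R -> 'cV[R]_3) (psi : R * R -> 'cV[R]_3) s : Ck 1 U psi ->
    (forall r, I r -> f r = psi (u r, v r)) -> I s ->
    derive1 f s = derive1 u s *: pdu psi (u s, v s) + derive1 v s *: pdv psi (u s, v s).
  move=> [dpsi _] fE Is; rewrite !derive1E.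
  rewrite (near_eq_derive _ (open_near_eq oI Is fE)).
  exact: derive_comp2 (duE s Is) (dvE s Is) (dpsi _ (Uw s Is)).
have tE s : I s -> derive1 gamma s = derive1 u s *: pdu phi (u s, v s) +
    derive1 v s *: pdv phi (u s, v s).
  by apply: velE (sphi 1%N) _ => r /wE[].
have tbE s : I s -> derive1 (F \o gamma) s = Fs (u s, v s) *m derive1 gamma s.
  move=> Is; have [_ Fa Fb _] := FsE _ (Uw s Is); rewrite (tE s Is).
  exact: etrans (velE _ _ s (sphib 1%N) gammabE Is) (esym (mulmx_comb _ _ Fa Fb)).
have dFs p : U p -> differentiable Fs p by have [+ _] := sFs 1%N; apply.
have accE s : I s -> derive1 (derive1 (F \o gamma)) s =
    (derive1 u s *: pdu Fs (u s, v s) + derive1 v s *: pdv Fs (u s, v s))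
      *m derive1 gamma s + Fs (u s, v s) *m derive1 (derive1 gamma) s.
  move=> Is; rewrite [LHS]derive1E (near_eq_derive _ (open_near_eq oI Is tbE)).
  have dA := differentiable_comp2 (duE s Is) (dvE s Is) (dFs _ (Uw s Is)).
  have [dt _] := derive1_Ck Cgamma.
  rewrite (derive_mulmx _ dA (dt s Is)).
  rewrite (derive_comp2 _ (duE s Is) (dvE s Is) (dFs _ (Uw s Is))).
  by rewrite !derive1E.
(* The relation [F_* phi_v = phibar_v] is differentiated in u and [F_* phi_u = phibar_u] in v;
   symmetry of second derivatives identifies the left sides and cancels the terms with [phi_uv]. *)
have FsuvE p : U p -> pdu Fs p *m pdv phi p = pdv Fs p *m pdu phi p.
  move=> Up.
  have [dphiu _] := Ck_pdu (sphi 2%N); have [dphiv _] := Ck_pdv (sphi 2%N).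
  have Eu : pdu (pdv (F \o phi)) p =
      pdu Fs p *m pdv phi p + Fs p *m pdu (pdv phi) p.
    rewrite -(derive_mulmx _ (dFs p Up) (dphiv p Up)).
    apply: near_eq_derive; apply: open_near_eq oU Up _ => q Uq.
    by have [_ _ + _] := FsE q Uq.
  have Ev : pdv (pdu (F \o phi)) p =
      pdv Fs p *m pdu phi p + Fs p *m pdv (pdu phi) p.
    rewrite -(derive_mulmx _ (dFs p Up) (dphiu p Up)).
    apply: near_eq_derive; apply: open_near_eq oU Up _ => q Uq.
    by have [_ + _ _] := FsE q Uq.
  have S1 : pdu (pdv (F \o phi)) p = pdv (pdu (F \o phi)) p.
    exact: derive_swap_mx oU Up (sphib 2%N).
  have S2 : pdu (pdv phi) p = pdv (pdu phi) p.
    exact: derive_swap_mx oU Up (sphi 2%N).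
  have cancel_acc (M : 'M[R]_3) (m1 m2 x y : 'cV[R]_3) :
    m1 + M *m x = m2 + M *m y -> x = y -> m1 = m2 by move=> E xy; apply: (addIr (M *m y)); rewrite -{1}xy.
  exact: cancel_acc (etrans (esym Eu) (etrans S1 Ev)) S2.
split; last by move=> s /gammaS; exact: FS.
split.
  split; first exact: Cgammab.
  move=> s Is; split; last exact: acc0.
  have [AA _ _ _] := FsE _ (Uw s Is).
  by rewrite (tbE s Is) (enorm_orthogonal _ AA); have [+ _] := unit_gamma s Is.
(* The new curvature is a factor here because the binormal of the image contains its inverse; their
   product is 1, as [acc0] makes this curvature nonzero. *)
exists lambda, (fun s => mu s / curvature gamma s * curvature (F \o gamma) s) => s Is.
have [AA Fa Fb FN] := FsE _ (Uw s Is).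
have kb0 : curvature (F \o gamma) s != 0 by rewrite enorm_eq0 acc0.
rewrite /binormal /unit_normal crossmulZr scalerA -mulrA divff // mulr1.
rewrite /tangent (accE s Is) (tbE s Is) (tE s Is).
apply: (image_position AA (N0 _ (Uw s Is)) _ (FsuvE _ (Uw s Is)) _ (posE s Is)).
  (* That [F_*] carries the normal to the normal is the one cross product known to be preserved,
     which fixes the orientation. *)
  exact: etrans FN (congr2 (@crossmul R) (esym Fa) (esym Fb)).
by rewrite -(tE s Is); exact: gammaE.
Qed.
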